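(* Let $(B,g_B),(F_1,g_{F_1}),\dots,(F_m,g_{F_m})$ be semi-Riemannian manifolds with $\dim B=n$, $\dim F_i=s_i$, let $b_1,\dots,b_m$ be smooth positive functions on $B$, and let $\lambda\in\mathbb{R}$. The multiply warped product $B\times_{b_1}F_1\times\cdots\times_{b_m}F_m$ is Einstein with $\mathrm{Ric}=\lambda g$ if and only if the following are all verified: (a) $\mathrm{Ric}_B=\lambda g_B+\sum_{i=1}^m\dfrac{s_i}{b_i}H_B^{b_i}$; (b) for every $i\in\{1,\dots,m\}$, $(F_i,g_{F_i})$ is Einstein with $\mathrm{Ric}_{F_i}=\mu_ig_{F_i}$ ($\mu_i$ constant); (c) for every $i\in\{1,\dots,m\}$, $$\lambda b_i^2=\mu_i-\left(b_i\Delta_Bb_i-\|\mathrm{grad}_Bb_i\|_B^2+\sum_{k=1}^m s_k\frac{b_i}{b_k}g_B(\mathrm{grad}_Bb_i,\mathrm{grad}_Bb_k)\right).$$ Furthermore, for each $i$ the equation in (c) is equivalent to $$b_i^2\left[\sum_{k=1}^m s_k\,g_B\Big(\frac{\mathrm{grad}_Bb_i}{b_i},\frac{\mathrm{grad}_Bb_k}{b_k}\Big)+\frac{\Delta_Bb_i}{b_i}-\frac{\|\mathrm{grad}_Bb_i\|_B^2}{b_i^2}+\lambda\right]-\mu_i=0.$$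
   Context: The multiply warped product $B\times_{b_1}F_1\times\cdots\times_{b_m}F_m$ is the product manifold $B\times F_1\times\cdots\times F_m$ with metric $g=g_B\oplus b_1^2g_{F_1}\oplus\cdots\oplus b_m^2g_{F_m}$, and $\mathrm{Ric}$ is its Ricci tensor (sign such that round spheres have positive Ricci curvature). A semi-Riemannian manifold is Einstein if its Ricci tensor is a constant multiple of its metric. For $f\in C^\infty(B)$, $\mathrm{grad}_Bf$ is the $g_B$-gradient, $H_B^f(X,Y)=XYf-(\nabla^B_XY)f$ the Hessian, $\Delta_Bf$ the $g_B$-trace of $H_B^f$, and $\|\mathrm{grad}_Bf\|_B^2=g_B(\mathrm{grad}_Bf,\mathrm{grad}_Bf)$. *)

(* Defs.v *)
From HB Require Import structures.
From mathcomp Require Import all_boot all_order all_algebra.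
From mathcomp Require Import all_classical all_reals all_analysis.
Set Implicit Arguments. Unset Strict Implicit. Unset Printing Implicit Defensive.
Import Order.TTheory GRing.Theory Num.Theory.
Import numFieldNormedType.Exports.
Local Open Scope classical_set_scope.
Local Open Scope ring_scope.

Definition partial (R : realType) (n : nat) (j : 'I_n) (f : 'rV[R]_n -> R) :
    'rV[R]_n -> R :=
  fun x => 'D_(delta_mx 0 j) f x.

(* C^oo on U (meant for open U): the iterated partial derivatives of every
   order exist and are continuous at every point of U. *)
Definition smooth_on (R : realType) (n : nat) (U : set 'rV[R]_n)
    (f : 'rV[R]_n -> R) : Prop :=
  forall (js : seq 'I_n) x, U x ->
    {for x, continuous (foldr (@partial R n) f js)} /\
    forall j, derivable (foldr (@partial R n) f js) x (delta_mx 0 j).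

(* [g x] is the Gram matrix of the metric in the coordinate frame at the
  coordinate point [x]; a vector field is identified with the row vector of its
  components in that frame; tensors are matrices of components. *)

Section Local.
Variables (R : realType) (n : nat) (g : 'rV[R]_n -> 'M[R]_n).
Implicit Types (X Y Z : 'rV[R]_n -> 'rV[R]_n) (f : 'rV[R]_n -> R).

Definition frame (j : 'I_n) : 'rV[R]_n -> 'rV[R]_n := fun=> delta_mx 0 j.

Definition vact X f : 'rV[R]_n -> R :=
  fun x => \sum_(j < n) X x 0 j * partial j f x.

Definition bracket X Y : 'rV[R]_n -> 'rV[R]_n :=
  fun x => \row_k (vact X (fun y => Y y 0 k) x - vact Y (fun y => X y 0 k) x).

(* Gamma^k_ij *)
Definition christoffel (k i j : 'I_n) (x : 'rV[R]_n) : R :=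
  2^-1 * \sum_(l < n) invmx (g x) k l *
    (partial i (fun y => g y j l) x + partial j (fun y => g y i l) x
     - partial l (fun y => g y i j) x).

Definition covd X Y : 'rV[R]_n -> 'rV[R]_n :=
  fun x => \row_k (vact X (fun y => Y y 0 k) x
    + \sum_(i < n) \sum_(j < n) christoffel k i j x * X x 0 i * Y x 0 j).

Definition curvature X Y Z : 'rV[R]_n -> 'rV[R]_n :=
  fun x => covd X (covd Y Z) x - covd Y (covd X Z) x - covd (bracket X Y) Z x.

(* Ric(Y, Z) = tr (X |-> R(X, Y) Z), positive on round spheres *)
Definition ricci (x : 'rV[R]_n) : 'M[R]_n :=
  \matrix_(j, k) \sum_(l < n) curvature (frame l) (frame j) (frame k) x 0 l.

Definition inner (x v w : 'rV[R]_n) : R := (v *m g x *m w^T) 0 0.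

(* the vector dual to df: inner x (gradient f x) w = df_x(w) *)
Definition gradient f (x : 'rV[R]_n) : 'rV[R]_n :=
  (\row_j partial j f x) *m invmx (g x).

Definition hessian_form f X Y : 'rV[R]_n -> R :=
  fun x => vact X (vact Y f) x - vact (covd X Y) f x.

Definition hessian f (x : 'rV[R]_n) : 'M[R]_n :=
  \matrix_(j, k) hessian_form f (frame j) (frame k) x.

Definition laplacian f (x : 'rV[R]_n) : R := \tr (invmx (g x) *m hessian f x).

End Local.

(* The index of a symmetric matrix: the largest dimension of a subspace (row
   space) on which the quadratic form v |-> v G v^T is negative definite. *)
Definition neg_definite_on (R : realType) (n : nat) (G V : 'M[R]_n) : Prop :=
  forall v : 'rV[R]_n, (v <= V)%MS -> v != 0 -> (v *m G *m v^T) 0 0 < 0.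

Definition has_index (R : realType) (n : nat) (G : 'M[R]_n) (nu : nat) : Prop :=
  (exists2 V : 'M[R]_n, neg_definite_on G V & \rank V = nu) /\
  (forall V : 'M[R]_n, neg_definite_on G V -> (\rank V <= nu)%N).

(* The data (a space, an atlas, and the components of a metric in every chart)
  is separated from the axioms, which are [semiRiemannian].  Tensor fields are
  given by their components in all charts. *)

Record metricAtlas (R : realType) (n : nat) := MetricAtlas {
  space :> topologicalType ;
  chart : Type ;
  dom : chart -> set space ;
  coord : chart -> space -> 'rV[R]_n ;       (* relevant on [dom c] *)
  param : chart -> 'rV[R]_n -> space ;       (* inverse of [coord c] *)
  gcoef : chart -> 'rV[R]_n -> 'M[R]_n       (* relevant on [img c] *)
}.
Arguments chart {R n} m.
Arguments dom {R n m} c.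
Arguments coord {R n m} c.
Arguments param {R n m} c.
Arguments gcoef {R n m} c.

Definition img (R : realType) (n : nat) (M : metricAtlas R n) (c : chart M) :
    set 'rV[R]_n :=
  coord c @` dom c.

Record semiRiemannian (R : realType) (n : nat) (M : metricAtlas R n) : Prop := {
  space_nonempty : [set: M] !=set0 ;
  space_hausdorff : hausdorff_space M ;
  space_second_countable : @second_countable M ;
  dom_cover : forall p : M, exists c : chart M, dom c p ;
  dom_open : forall c : chart M, open (dom c) ;
  img_open : forall c : chart M, open (img c) ;
  coordK : forall (c : chart M) p, dom c p -> param c (coord c p) = p ;
  coord_continuous : forall (c : chart M) p, dom c p ->
    {for p, continuous (coord c)} ;
  param_continuous : forall (c : chart M) x, img c x ->
    {for x, continuous (param c)} ;
  transition_smooth : forall (c c' : chart M) k,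
    smooth_on (coord c @` (dom c `&` dom c')) (fun x => coord c' (param c x) 0 k) ;
  metric_smooth : forall (c : chart M) i j,
    smooth_on (img c) (fun x => gcoef c x i j) ;
  metric_sym : forall (c : chart M) x, img c x -> (gcoef c x)^T = gcoef c x ;
  metric_nondegenerate : forall (c : chart M) x, img c x -> gcoef c x \in unitmx ;
  metric_index : exists nu : nat, forall (c : chart M) x,
    img c x -> has_index (gcoef c x) nu ;
  metric_transition : forall (c c' : chart M) p, dom c p -> dom c' p ->
    let J := jacobian (coord c' \o param c) (coord c p) in
    gcoef c (coord c p) = J *m gcoef c' (coord c' p) *m J^T
}.

Section OnManifold.
Variables (R : realType) (n : nat) (M : metricAtlas R n).
Implicit Types (c : chart M) (p : M) (f : M -> R).

Definition smooth_fun f : Prop :=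
  forall c, smooth_on (img c) (f \o param c).

(* Components, in the chart c, at the point p of its domain. *)
Definition metric c p : 'M[R]_n := gcoef c (coord c p).
Definition Ric c p : 'M[R]_n := ricci (gcoef c) (coord c p).
Definition ip c p (v w : 'rV[R]_n) : R := inner (gcoef c) (coord c p) v w.
Definition grad c f p : 'rV[R]_n :=
  gradient (gcoef c) (f \o param c) (coord c p).
Definition Hess c f p : 'M[R]_n :=
  hessian (gcoef c) (f \o param c) (coord c p).
Definition Lap c f p : R :=
  laplacian (gcoef c) (f \o param c) (coord c p).

Definition einstein (mu : R) : Prop :=
  forall c p, dom c p -> Ric c p = mu *: metric c p.

End OnManifold.

Section Warped.
Variables (R : realType) (n m : nat) (s : 'I_m -> nat).
Variables (B : metricAtlas R n) (F : forall i, metricAtlas R (s i)).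
Variable b : 'I_m -> B -> R.

Definition wspace : topologicalType :=
  (B * prod_topology (fun i => space (F i)))%type.

Definition wchart : Type := (chart B * forall i, chart (F i))%type.

Definition wdom (c : wchart) : set wspace :=
  [set p | dom c.1 p.1 /\ forall i, dom (c.2 i) (p.2 i)].

Definition wcoord (c : wchart) (p : wspace) : 'rV[R]_(n + \sum_(i < m) s i) :=
  row_mx (coord c.1 p.1) (\mxrow_(i < m) coord (c.2 i) (p.2 i)).

Definition wparam (c : wchart) (x : 'rV[R]_(n + \sum_(i < m) s i)) : wspace :=
  (param c.1 (lsubmx x), fun i => param (c.2 i) (submxrow (rsubmx x) i)).

Definition wgcoef (c : wchart) (x : 'rV[R]_(n + \sum_(i < m) s i)) :
    'M[R]_(n + \sum_(i < m) s i) :=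
  block_mx (gcoef c.1 (lsubmx x)) 0 0
    (\mxdiag_(i < m) (b i (param c.1 (lsubmx x)) ^+ 2 *:
                      gcoef (c.2 i) (submxrow (rsubmx x) i))).

Definition warped : metricAtlas R (n + \sum_(i < m) s i) :=
  MetricAtlas wdom wcoord wparam wgcoef.

End Warped.

(* Main.v *)
(* Everything is computed in product charts, where the metric is the block
   matrix with blocks g_B and b_i^2 g_(F_i).  Its Christoffel symbols are those
   of the base and of the fibers, together with
     Gamma^(F_i)_(B a, F_i) = (d_a b_i / b_i) id,
     Gamma^(B c)_(F_i, F_i) = - b_i (grad b_i)^c g_(F_i),
   and all others vanish.  Hence the Ricci matrix is block diagonal, with base
   block Ric_B - sum_i (s_i / b_i) H^(b_i) and fiber blocks Ric_(F_i) - Q_i g_(F_i),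
   where Q_i = b_i Delta b_i - |grad b_i|^2
               + sum_k s_k (b_i / b_k) g(grad b_i, grad b_k);
   the Laplacian enters as the divergence of grad b_i.  So Ric = lambda g says (a)
   and Ric_(F_i) = (lambda b_i^2 + Q_i) g_(F_i).  The factor depends on the point
   of B and on the chart only, the other terms on the point of F_i only, and
   g_(F_i) <> 0 because s_i > 0: the factor is a constant mu_i, without any
   connectedness assumption. *)
Require Import Defs.
From HB Require Import structures.
From mathcomp Require Import all_boot all_order all_algebra.
From mathcomp Require Import all_classical all_reals all_analysis.
From mathcomp Require Import ring.
Set Implicit Arguments.
Unset Strict Implicit.
Unset Printing Implicit Defensive.
Import Order.TTheory GRing.Theory Num.Theory.
Import numFieldNormedType.Exports.
Local Open Scope classical_set_scope.
Local Open Scope ring_scope.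

(** * Locality of partial derivatives *)

Section PartialDerivatives.
Variables (R : realType).
Implicit Types n : nat.

(** The dimensions may differ, because a partial derivative only sees the germ of the function along
    one coordinate line. This is how derivatives on the product are compared with derivatives on a
    factor. *)
Lemma partial_eq_near n n' (j : 'I_n) (j' : 'I_n') f f' x x' :
  (\forall h \near (0 : R),
     f (h *: delta_mx 0 j + x) = f' (h *: delta_mx 0 j' + x')) ->
  partial j f x = partial j' f' x'.
Proof.
move=> ff'; have fx : f x = f' x'.
  by have /= := nbhs_singleton ff'; rewrite !scale0r !add0r.
rewrite /partial /derive; congr (lim _).
rewrite eqEsubset; split; apply/near_eq_cvg/cvg_within;
  by apply: filterS ff' => h /= ->; rewrite fx.
Qed.

Lemma partial_eq n n' (j : 'I_n) (j' : 'I_n') (f : _ -> R) f' x x' :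
  (forall h, f (h *: delta_mx 0 j + x) = f' (h *: delta_mx 0 j' + x')) ->
  partial j f x = partial j' f' x'.
Proof. by move=> ff'; apply: partial_eq_near; near=> h. Unshelve. all: by end_near. Qed.

Lemma open_near_line n (U : set 'rV[R]_n) (v x : 'rV[R]_n) :
  open U -> U x -> \forall h \near (0 : R), U (h *: v + x).
Proof.
move=> oU Ux; have : (h *: v + x) @[h --> (0 : R)] --> 0 *: v + x.
  by apply: cvgD; [apply: cvgZr_tmp; exact: cvg_id | exact: cvg_cst].
by apply; rewrite scale0r add0r; exact: open_nbhs_nbhs.
Qed.

Lemma eq_partial n (U : set 'rV[R]_n) (j : 'I_n) f f' x :
  open U -> U x -> {in U, f =1 f'} -> partial j f x = partial j f' x.
Proof.
move=> oU Ux ff'; apply: near_eq_derive.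
by apply: filterS (open_nbhs_nbhs (conj oU Ux)) => y Uy; apply: ff'; rewrite inE.
Qed.

Lemma partial_cst n (j : 'I_n) (c : R) x : partial j (cst c) x = 0.
Proof. exact: derive_cst. Qed.

Lemma smooth_derivable n (U : set 'rV[R]_n) f x (j : 'I_n) :
  smooth_on U f -> U x -> derivable f x (delta_mx 0 j).
Proof. by move=> sf Ux; have [] := sf [::] x Ux. Qed.

Lemma smooth_partial_derivable n (U : set 'rV[R]_n) f x (i j : 'I_n) :
  smooth_on U f -> U x -> derivable (partial i f) x (delta_mx 0 j).
Proof. by move=> sf Ux; have [] := sf [:: i] x Ux. Qed.

End PartialDerivatives.

(** * Hessian and Ricci tensor in terms of Christoffel symbols *)

Section Coordinates.
Variables (R : realType) (n : nat) (g : 'rV[R]_n -> 'M[R]_n).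

Lemma vact_frame (j : 'I_n) f : vact (@frame R n j) f = partial j f.
Proof.
apply/funext => x; rewrite /vact (bigD1 j)//= /frame mxE !eqxx mul1r.
by rewrite big1 ?addr0// => i ij; rewrite mxE eqxx (negbTE ij) mul0r.
Qed.

Lemma covd_frame (i : 'I_n) X x :
  covd g (frame i) X x =
  \row_k (partial i (fun y => X y 0 k) x + \sum_j christoffel g k i j x * X x 0 j).
Proof.
apply/rowP => k; rewrite !mxE vact_frame; congr (_ + _).
rewrite (bigD1 i)//= [X in _ + X]big1 ?addr0.
  by apply: eq_bigr => j _; rewrite /frame mxE !eqxx mulr1.
move=> l li; apply: big1 => j _.
by rewrite /frame mxE eqxx (negbTE li) mulr0 mul0r.
Qed.

Lemma covd_frames (i j : 'I_n) x :
  covd g (frame i) (frame j) x = \row_k christoffel g k i j x.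
Proof.
rewrite covd_frame; apply/rowP => k; rewrite !mxE partial_cst add0r.
rewrite (bigD1 j)//= /frame mxE !eqxx mulr1 big1 ?addr0// => l lj.
by rewrite mxE eqxx (negbTE lj) mulr0.
Qed.

Lemma hessianE f x (j k : 'I_n) :
  hessian g f x j k =
  partial j (partial k f) x - \sum_l christoffel g l j k x * partial l f x.
Proof.
rewrite mxE /hessian_form !vact_frame; congr (_ - _); rewrite /vact.
by rewrite covd_frames; apply: eq_bigr => l _; rewrite mxE.
Qed.

Lemma curvature_frames (l j k : 'I_n) x :
  curvature g (frame l) (frame j) (frame k) x 0 l =
  partial l (christoffel g l j k) x - partial j (christoffel g l l k) x
  + \sum_a christoffel g l l a x * christoffel g a j k x
  - \sum_a christoffel g l j a x * christoffel g a l k x.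
Proof.
(* Coordinate fields have constant components, so they commute and the bracket term of the curvature
   drops out. *)
have b0 : bracket (@frame R n l) (frame j) = (fun=> 0).
  apply/funext => y; apply/rowP => k'.
  by rewrite mxE !vact_frame !partial_cst subrr mxE.
have c0 : covd g (fun=> 0) (frame k) x = 0.
  apply/rowP => k'; rewrite [RHS]mxE mxE /vact big1 => [|i _]; last first.
    by rewrite mxE mul0r.
  rewrite add0r; apply: big1 => i _; apply: big1 => a _.
  by rewrite mxE mulr0 mul0r.
have cE a b c : (fun y => covd g (frame a) (frame b) y 0 c) = christoffel g c a b.
  by apply/funext => y; rewrite covd_frames mxE.
rewrite /curvature b0 c0 subr0.
rewrite (covd_frame l (covd g (frame j) (frame k))).
rewrite (covd_frame j (covd g (frame l) (frame k))) 4!mxE !cE opprD addrACA addrA.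
by congr (_ + _ + _ - _); apply: eq_bigr => a _; rewrite covd_frames mxE.
Qed.

Lemma ricciE x (j k : 'I_n) :
  ricci g x j k =
  \sum_l partial l (christoffel g l j k) x
  - \sum_l partial j (christoffel g l l k) x
  + \sum_a (\sum_l christoffel g l l a x) * christoffel g a j k x
  - \sum_l \sum_a christoffel g l j a x * christoffel g a l k x.
Proof.
rewrite mxE; under eq_bigr do rewrite curvature_frames.
rewrite !big_split/= !sumrN; congr (_ + _ - _).
rewrite exchange_big/=; apply: eq_bigr => a _.
by rewrite mulr_suml.
Qed.

(** Lets the four sums of the classical formula for the Ricci tensor be evaluated one at a time for
    each pair of blocks. *)
Lemma ricci_parts x (j k : 'I_n) (t1 t2 t3 t4 : R) :
  \sum_l partial l (christoffel g l j k) x = t1 ->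
  \sum_l partial j (christoffel g l l k) x = t2 ->
  \sum_a (\sum_l christoffel g l l a x) * christoffel g a j k x = t3 ->
  \sum_l \sum_a christoffel g l j a x * christoffel g a l k x = t4 ->
  ricci g x j k = t1 - t2 + t3 - t4.
Proof. by move=> <- <- <- <-; exact: ricciE. Qed.

End Coordinates.

(** * Derivatives of sums, determinants and inverse matrices *)

Section MatrixDerivative.
Variables (R : realType) (V : normedModType R).
Implicit Types (x v : V).

Lemma derivable_bigsum (I : Type) (r : seq I) (P : pred I) (h : I -> V -> R) x v :
  (forall i, P i -> derivable (h i) x v) ->
  derivable (fun y => \sum_(i <- r | P i) h i y) x v.
Proof.
move=> dh; elim: r => [|i r IH].
  by under eq_fun do rewrite big_nil; exact: derivable_cst.
under eq_fun do rewrite big_cons; case: ifPn => // Pi.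
by apply: derivableD => //; exact: dh.
Qed.

Lemma derive_bigsum (I : Type) (r : seq I) (P : pred I) (h : I -> V -> R) x v :
  (forall i, P i -> derivable (h i) x v) ->
  'D_v (fun y => \sum_(i <- r | P i) h i y) x = \sum_(i <- r | P i) 'D_v (h i) x.
Proof.
move=> dh; elim: r => [|i r IH].
  by under eq_fun do rewrite big_nil; rewrite big_nil derive_cst.
under eq_fun do rewrite big_cons; rewrite big_cons; case: ifPn => // Pi.
rewrite -IH; apply: deriveD; first exact: dh.
exact: derivable_bigsum.
Qed.

Lemma derivable_bigprod (I : Type) (r : seq I) (P : pred I) (h : I -> V -> R) x v :
  (forall i, P i -> derivable (h i) x v) ->
  derivable (fun y => \prod_(i <- r | P i) h i y) x v.
Proof.
move=> dh; elim: r => [|i r IH].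
  by under eq_fun do rewrite big_nil; exact: derivable_cst.
under eq_fun do rewrite big_cons; case: ifPn => // Pi.
by apply: derivableM => //; exact: dh.
Qed.

Lemma derivable_det n (A : V -> 'M[R]_n) x v :
  (forall i j, derivable (fun y => A y i j) x v) ->
  derivable (fun y => \det (A y)) x v.
Proof.
move=> dA; rewrite /determinant.
apply: derivable_bigsum => s _; apply: derivableM; first exact: derivable_cst.
exact: derivable_bigprod.
Qed.

(** Near [x] the inverse is the adjugate divided by the determinant, and both are polynomial in the
    entries. *)
Lemma derivable_invmx n (A : V -> 'M[R]_n) x v (i j : 'I_n) :
  (\forall y \near x, A y \in unitmx) ->
  (forall i j, derivable (fun y => A y i j) x v) ->
  derivable (fun y => invmx (A y) i j) x v.
Proof.
move=> uA dA.
apply: (@near_eq_derivable _ _ _ (fun y => (\det (A y))^-1 * cofactor (A y) j i)).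
  by apply: filterS uA => y uy; rewrite /invmx uy !mxE.
apply: derivableM.
  apply: derivableV; last exact: derivable_det.
  by have := nbhs_singleton uA; rewrite unitmxE unitfE.
apply: derivableM; first exact: derivable_cst.
by apply: derivable_det => k l; under eq_fun do rewrite !mxE; exact: dA.
Qed.

(** Differentiating [A^-1 A = 1], which holds near [x], gives [D A + A^-1 D' = 0]; multiplication on
    the right by [A^-1] isolates [D]. *)
Lemma derive_invmx n (A : V -> 'M[R]_n) x v :
  (\forall y \near x, A y \in unitmx) ->
  (forall i j, derivable (fun y => A y i j) x v) ->
  \matrix_(i, j) 'D_v (fun y => invmx (A y) i j) x =
  - (invmx (A x) *m (\matrix_(i, j) 'D_v (fun y => A y i j) x) *m invmx (A x)).
Proof.
move=> uA dA; have uAx := nbhs_singleton uA.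
have dI i j := @derivable_invmx _ _ _ _ i j uA dA.
set D := \matrix_(i, j) _; set D' := \matrix_(i, j) _.
suff /(congr1 (mulmx^~ (invmx (A x)))) : D *m A x + invmx (A x) *m D' = 0.
  rewrite mulmxDl mul0mx -(mulmxA D) mulmxV// mulmx1.
  by move/eqP; rewrite addr_eq0 => /eqP.
apply/matrixP => i j; rewrite !mxE -big_split/=.
transitivity ('D_v (fun y => \sum_k invmx (A y) i k * A y k j) x).
  rewrite derive_bigsum; last by move=> k _; exact: derivableM.
  apply: eq_bigr => k _; rewrite deriveM// !mxE addrC.
  by congr (_ + _); exact: mulrC.
apply: etrans (@derive_cst _ V R ((1%:M : 'M[R]_n) i j) x v).
apply: near_eq_derive; apply: filterS uA => y uy.
by rewrite -(mulVmx uy) mxE.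
Qed.

End MatrixDerivative.

(** * The Laplacian as the divergence of the gradient *)

Section Laplacian.
Variables (R : realType) (n : nat) (g : 'rV[R]_n -> 'M[R]_n) (U : set 'rV[R]_n).
Hypotheses (oU : open U) (smg : forall i j, smooth_on U (fun x => g x i j)).
Hypotheses (symg : forall x, U x -> (g x)^T = g x).
Hypotheses (unitg : forall x, U x -> g x \in unitmx).

Lemma metric_entry_sym x (i j : 'I_n) : U x -> g x i j = g x j i.
Proof. by move=> Ux; rewrite -[in LHS]symg// mxE. Qed.

Lemma invmx_entry_sym x (i j : 'I_n) : U x -> invmx (g x) i j = invmx (g x) j i.
Proof. by move=> Ux; rewrite -[in LHS]symg// -trmx_inv mxE. Qed.

Lemma partial_metric_sym x (i j k : 'I_n) : U x ->
  partial k (fun y => g y i j) x = partial k (fun y => g y j i) x.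
Proof.
move=> Ux; apply: (@eq_partial _ _ U) => // y; rewrite inE => Uy.
exact: metric_entry_sym.
Qed.

(** Symmetry is assumed for the one entry pair [(i, j)] only, so that the lemma also serves the
    mixed entries of the warped metric, whose derivatives are all zero. *)
Lemma christoffel_swap (h : 'rV[R]_n -> 'M[R]_n) x (i j k : 'I_n) :
  (forall l, partial l (fun y => h y i j) x = partial l (fun y => h y j i) x) ->
  christoffel h k i j x = christoffel h k j i x.
Proof.
move=> hij; congr (_ * _); apply: eq_bigr => l _; congr (_ * _).
by congr (_ - _); [exact: addrC | exact: hij].
Qed.

Lemma christoffel_sym x (i j k : 'I_n) : U x ->
  christoffel g k i j x = christoffel g k j i x.
Proof.
by move=> Ux; apply: christoffel_swap => l; exact: partial_metric_sym.
Qed.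

Lemma gradientE f x (c : 'I_n) :
  gradient g f x 0 c = \sum_a partial a f x * invmx (g x) a c.
Proof. by rewrite mxE; apply: eq_bigr => a _; rewrite mxE. Qed.

Lemma derivable_gradient f x (c k : 'I_n) : smooth_on U f -> U x ->
  derivable (fun y => gradient g f y 0 c) x (delta_mx 0 k).
Proof.
move=> smf Ux; under eq_fun do rewrite gradientE.
apply: derivable_bigsum => a _; apply: derivableM.
  exact: smooth_partial_derivable smf Ux.
apply: derivable_invmx => [|i j]; last exact: smooth_derivable (smg i j) Ux.
by apply: filterS (open_nbhs_nbhs (conj oU Ux)).
Qed.

Lemma partial_gradient f x (c k : 'I_n) : smooth_on U f -> U x ->
  partial k (fun y => gradient g f y 0 c) x =
  \sum_a partial k (partial a f) x * invmx (g x) a c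
  - \sum_a partial a f x *
      \sum_e \sum_d invmx (g x) a e * partial k (fun y => g y e d) x * invmx (g x) d c.
Proof.
move=> smf Ux; under eq_fun do rewrite gradientE.
have nU : \forall y \near x, g y \in unitmx.
  by apply: filterS (open_nbhs_nbhs (conj oU Ux)).
have dg i j := smooth_derivable (j := k) (smg i j) Ux.
have df a := smooth_partial_derivable (i := a) (j := k) smf Ux.
have dI a := derivable_invmx (i := a) (j := c) nU dg.
rewrite /partial derive_bigsum => [|a _]; last exact: derivableM (df a) (dI a).
rewrite -sumrB; apply: eq_bigr => a _.
rewrite (deriveM (df a) (dI a)).
have /matrixP/(_ a c) := derive_invmx nU dg; rewrite mxE => ->.
rewrite addrC; congr (_ + _); first exact: mulrC.
rewrite !mxE -mulrN; congr (_ * _); congr (- _).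
rewrite exchange_big/=; apply: eq_bigr => d _.
by rewrite mxE mulr_suml; apply: eq_bigr => e _; rewrite mxE.
Qed.

(** The two other terms of the symbol form an expression antisymmetric in [c] and [l], which the
    symmetric inverse metric annihilates. *)
Lemma christoffel_trace x (d : 'I_n) : U x ->
  \sum_c christoffel g c c d x =
  2^-1 * \sum_c \sum_l invmx (g x) c l * partial d (fun y => g y c l) x.
Proof.
move=> Ux; rewrite -mulr_sumr; congr (_ * _).
apply/eqP; rewrite -subr_eq0 -sumrB; apply/eqP.
under eq_bigr do [rewrite -sumrB; under eq_bigr do rewrite -mulrBr addrAC addrK mulrBr].
under eq_bigr do rewrite sumrB.
rewrite sumrB; apply/eqP; rewrite subr_eq0; apply/eqP.
rewrite [RHS]exchange_big/=; apply: eq_bigr => c _; apply: eq_bigr => l _.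
by rewrite (invmx_entry_sym l)// (partial_metric_sym l).
Qed.

(** This is the contraction of [nabla g^-1 = 0]: the right-hand side is minus the sum over [c] of
    the [c]-th derivatives of [g^(ac)]. In the proof the two terms on the left equal [T / 2] and
    [S - T / 2], and [S] is the right-hand side. *)
Lemma christoffel_contraction x (a : 'I_n) : U x ->
  \sum_d (\sum_c christoffel g c c d x) * invmx (g x) a d
  + \sum_b \sum_c invmx (g x) b c * christoffel g a c b x =
  \sum_c \sum_e \sum_d invmx (g x) a e * partial c (fun y => g y e d) x
                        * invmx (g x) d c.
Proof.
move=> Ux; set I := invmx (g x); pose P k i j := partial k (fun y => g y i j) x.
have Psym k i j : P k i j = P k j i by exact: partial_metric_sym.
have Isym i j : I i j = I j i by exact: invmx_entry_sym.
pose S := \sum_b \sum_c \sum_l I b c * (I a l * P c b l).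
pose T := \sum_b \sum_c \sum_l I b c * (I a l * P l b c).
have -> : \sum_d (\sum_c christoffel g c c d x) * I a d = 2^-1 * T.
  under eq_bigr => d _.
    rewrite christoffel_trace// -mulrA mulr_suml.
    under eq_bigr do rewrite mulr_suml; over.
  rewrite -mulr_sumr; congr (_ * _).
  rewrite exchange_big; apply: eq_bigr => b _; rewrite exchange_big/=.
  by apply: eq_bigr => c _; apply: eq_bigr => l _; rewrite -mulrA [_ * I a l]mulrC.
have -> : \sum_b \sum_c I b c * christoffel g a c b x = S - 2^-1 * T.
  (* The first two terms of the Christoffel symbol have the same contraction with the symmetric
     matrix [I], so each contributes one half of [S]. *)
  pose S' := \sum_b \sum_c \sum_l I b c * (I a l * P b c l).
  have SS' : S = S'.
    rewrite /S exchange_big; apply: eq_bigr => b _; apply: eq_bigr => c _.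
    by rewrite (Isym c).
  have -> : S = 2^-1 * (S + S').
    by rewrite -SS' -mulr2n -[S *+ 2]mulr_natl mulrA mulVf ?mul1r ?pnatr_eq0.
  rewrite -mulrBr.
  rewrite -big_split -sumrB mulr_sumr; apply: eq_bigr => b _ /=.
  rewrite -big_split -sumrB mulr_sumr; apply: eq_bigr => c _ /=.
  rewrite -big_split -sumrB /christoffel mulrCA; congr (_ * _).
  rewrite mulr_sumr; apply: eq_bigr => l _ /=; rewrite -/I.
  rewrite [P l b c]Psym /P; ring.
rewrite addrC subrK /S exchange_big/=; apply: eq_bigr => c _.
rewrite exchange_big/=; apply: eq_bigr => l _; apply: eq_bigr => b _.
by rewrite [P c b l]Psym mulrC (Isym b).
Qed.

(* Compatibility of the connection with the metric makes the divergence of the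
   gradient the trace of the Hessian. *)
Lemma divergence_gradient f x : smooth_on U f -> U x ->
  \sum_c partial c (fun y => gradient g f y 0 c) x
  + \sum_d (\sum_c christoffel g c c d x) * gradient g f x 0 d = laplacian g f x.
Proof.
move=> smf Ux; set I := invmx (g x).
under eq_bigr do rewrite partial_gradient//.
rewrite sumrB.
under [X in _ + X = _]eq_bigr do rewrite gradientE mulr_sumr.
rewrite [X in _ + X = _]exchange_big/= [X in _ - X + _]exchange_big/=.
rewrite /laplacian /mxtrace.
under [RHS]eq_bigr => a _.
  rewrite mxE; under eq_bigr do rewrite hessianE mulrBr.
  rewrite sumrB; over.
rewrite sumrB [X in X - _ + _]exchange_big/= -addrA; congr (_ + _).
  by apply: eq_bigr => a _; apply: eq_bigr => b _; exact: mulrC.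
have -> : \sum_a \sum_b I a b * \sum_l christoffel g l b a x * partial l f x =
          \sum_l partial l f x * \sum_a \sum_b I a b * christoffel g l b a x.
  under [RHS]eq_bigr do rewrite mulr_sumr.
  rewrite [RHS]exchange_big; apply: eq_bigr => a _.
  under [RHS]eq_bigr do rewrite mulr_sumr.
  rewrite [RHS]exchange_big; apply: eq_bigr => b _.
  by rewrite mulr_sumr; apply: eq_bigr => l _; ring.
(* The second derivatives of [f] are matched by now; what remains is linear in the first
   derivatives, and their coefficients agree by [christoffel_contraction]. *)
rewrite -!sumrN -big_split; apply: eq_bigr => a _ /=.
rewrite -mulr_sumr -christoffel_contraction// -/I.
under [X in _ + X = _]eq_bigr do rewrite mulrCA.
rewrite -mulr_sumr; ring.
Qed.

End Laplacian.

(** * Base and fiber indices of the product, and sums over them *)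

Section WarpedIndices.
Variables (n m : nat) (s : 'I_m -> nat).

Definition base_idx (a : 'I_n) : 'I_(n + \sum_(i < m) s i) := lshift _ a.
(** [tagnat.Rank] is the flattening of pairs behind [\mxrow] and [\mxdiag], so an entry at such an
    index is an entry of a block. *)
Definition fiber_idx (i : 'I_m) (al : 'I_(s i)) : 'I_(n + \sum_(i < m) s i) :=
  rshift n (tagnat.Rank i al).

Arguments fiber_idx : clear implicits.

Lemma widxP (P : 'I_(n + \sum_(i < m) s i) -> Prop) :
  (forall a, P (base_idx a)) -> (forall i al, P (fiber_idx i al)) ->
  forall l, P l.
Proof.
move=> PB PF l; rewrite -[l]splitK; case: (fintype.split l) => [a|r] /=; first exact: PB.
by rewrite -(tagnat.sig2K r); exact: PF.
Qed.

Lemma fiber_idx_eq i (al be : 'I_(s i)) :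
  (fiber_idx i al == fiber_idx i be) = (al == be).
Proof.
by rewrite (inj_eq (@rshift_inj _ _)) -val_eqE /= tagnat.eq_Rank eqxx.
Qed.

Lemma fiber_idx_neq i j (al : 'I_(s i)) (be : 'I_(s j)) : i != j ->
  (fiber_idx i al == fiber_idx j be) = false.
Proof.
move=> /negbTE ij.
by rewrite (inj_eq (@rshift_inj _ _)) -val_eqE /= tagnat.eq_Rank ij.
Qed.

Lemma base_fiber_idx_neq a i al : (base_idx a == fiber_idx i al) = false.
Proof. exact: eq_lrshift. Qed.

Section Sums.
Variables (V : nmodType) (f : 'I_(n + \sum_(i < m) s i) -> V).

(** The variants that follow match the vanishing patterns of the Christoffel symbols: only base
    indices, only the indices of one fiber, or none contribute. *)
Lemma big_widx :
  \sum_l f l = \sum_a f (base_idx a) + \sum_i \sum_al f (fiber_idx i al).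
Proof.
rewrite big_split_ord/=; congr (_ + _).
by rewrite sig_big_dep/= (reindex _ tagnat.rank_bij_on)/=; apply: eq_bigr => -[].
Qed.

Lemma big_widx_base : (forall i al, f (fiber_idx i al) = 0) ->
  \sum_l f l = \sum_a f (base_idx a).
Proof.
move=> f0; rewrite big_widx [X in _ + X]big1 ?addr0// => i _.
by rewrite big1.
Qed.

Lemma big_widx_fiber i :
  (forall a, f (base_idx a) = 0) ->
  (forall j al, j != i -> f (fiber_idx j al) = 0) ->
  \sum_l f l = \sum_al f (fiber_idx i al).
Proof.
move=> fB fF; rewrite big_widx big1// add0r (bigD1 i)//= [X in _ + X]big1 ?addr0//.
by move=> j ji; rewrite big1// => al _; exact: fF.
Qed.

Lemma big_widx0 :
  (forall a, f (base_idx a) = 0) -> (forall j al, f (fiber_idx j al) = 0) ->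
  \sum_l f l = 0.
Proof. by move=> fB fF; apply: big1 => l _; move: l; exact: widxP. Qed.

End Sums.
End WarpedIndices.
Arguments base_idx {n m s} a.
Arguments fiber_idx n {m s} i al.

(** * Entries of a block diagonal matrix *)

Section BlockEntries.
Variables (R : nmodType) (n m : nat) (s : 'I_m -> nat).
Variables (A : 'M[R]_n) (D : forall i : 'I_m, 'M[R]_(s i)).
Let G := block_mx A 0 0 (\mxdiag_(i < m) D i).

Lemma block_diag_base a b : G (base_idx a) (base_idx b) = A a b.
Proof. exact: block_mxEul. Qed.

Lemma block_diag_base_fiber a i al : G (base_idx a) (fiber_idx n i al) = 0.
Proof. by rewrite /G block_mxEur mxE. Qed.

Lemma block_diag_fiber_base a i al : G (fiber_idx n i al) (base_idx a) = 0.
Proof. by rewrite /G block_mxEdl mxE. Qed.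

Lemma block_diag_fiber i al be : G (fiber_idx n i al) (fiber_idx n i be) = D i al be.
Proof. by rewrite /G block_mxEdr -[in RHS](submxblock_diag D i) [RHS]mxE. Qed.

Lemma block_diag_fiber_neq i j al be : i != j ->
  G (fiber_idx n i al) (fiber_idx n j be) = 0.
Proof.
move=> ij; rewrite /G block_mxEdr.
transitivity (submxblock (\mxdiag_(i < m) D i) i j al be); first by rewrite [RHS]mxE.
by rewrite /mxdiag mxblockK (negbTE ij) mxE.
Qed.

End BlockEntries.

(** * Partial derivatives on the product of functions from the factors *)

Section WarpedDerivatives.
Variables (R : realType) (n m : nat) (s : 'I_m -> nat).
Implicit Types x : 'rV[R]_(n + \sum_(i < m) s i).

Definition base_part x : 'rV[R]_n := lsubmx x.
Definition fiber_part x (i : 'I_m) : 'rV[R]_(s i) := submxrow (rsubmx x) i.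

Lemma base_part_line (h : R) v x :
  base_part (h *: v + x) = h *: base_part v + base_part x.
Proof. by apply/rowP => i; rewrite !mxE. Qed.

Lemma fiber_part_line (h : R) v x i :
  fiber_part (h *: v + x) i = h *: fiber_part v i + fiber_part x i.
Proof. by apply/rowP => j; rewrite !mxE. Qed.

Lemma base_part_base a : base_part (delta_mx 0 (base_idx a)) = delta_mx 0 a.
Proof. by apply/rowP => i; rewrite !mxE eqxx/= (inj_eq (@lshift_inj _ _)). Qed.

Lemma base_part_fiber i al : base_part (delta_mx 0 (fiber_idx n i al)) = 0.
Proof. by apply/rowP => j; rewrite !mxE base_fiber_idx_neq andbF. Qed.

Lemma fiber_part_base a i : fiber_part (delta_mx 0 (base_idx a)) i = 0.
Proof. by apply/rowP => j; rewrite !mxE eq_sym base_fiber_idx_neq andbF. Qed.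

Lemma fiber_part_fiber i al :
  fiber_part (delta_mx 0 (fiber_idx n i al)) i = delta_mx 0 al.
Proof. by apply/rowP => j; rewrite !mxE eqxx/= fiber_idx_eq. Qed.

Lemma fiber_part_fiber_neq i j al : i != j ->
  fiber_part (delta_mx 0 (fiber_idx n i al)) j = 0.
Proof. by move=> ij; apply/rowP => k; rewrite !mxE eq_sym fiber_idx_neq ?andbF. Qed.

Definition wpartE := (base_part_line, fiber_part_line, base_part_base,
  base_part_fiber, fiber_part_base, fiber_part_fiber, scaler0, add0r).

Section Products.
Variables (i j : 'I_m) (h : 'rV[R]_n -> R).

Lemma partial_base_base a x :
  partial (base_idx a) (fun y => h (base_part y)) x = partial a h (base_part x).
Proof. by apply: partial_eq => t; rewrite !wpartE. Qed.

Lemma partial_fiber_base al x :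
  partial (fiber_idx n i al) (fun y => h (base_part y)) x = 0.
Proof.
rewrite -(partial_cst (fiber_idx n i al) (h (base_part x)) x).
by apply: partial_eq => t; rewrite !wpartE.
Qed.

Lemma partial_base_fiber (k : 'rV[R]_(s i) -> R) a x :
  partial (base_idx a) (fun y => k (fiber_part y i)) x = 0.
Proof.
rewrite -(partial_cst (base_idx a) (k (fiber_part x i)) x).
by apply: partial_eq => t; rewrite !wpartE.
Qed.

Lemma partial_fiber_fiber (k : 'rV[R]_(s i) -> R) al x :
  partial (fiber_idx n i al) (fun y => k (fiber_part y i)) x =
  partial al k (fiber_part x i).
Proof. by apply: partial_eq => t; rewrite !wpartE. Qed.

Lemma partial_fiber_fiber_neq (k : 'rV[R]_(s j) -> R) al x : i != j ->
  partial (fiber_idx n i al) (fun y => k (fiber_part y j)) x = 0.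
Proof.
move=> ij; rewrite -(partial_cst (fiber_idx n i al) (k (fiber_part x j)) x).
by apply: partial_eq => t; rewrite !wpartE fiber_part_fiber_neq// !wpartE.
Qed.

(** Along a base line the fiber factor is a constant, so this is the rule for scalar multiples and
    needs no differentiability of [k]. The fiber direction is treated in the same way with the roles
    exchanged. *)
Lemma partial_base_prod (k : 'rV[R]_(s i) -> R) a x :
  derivable h (base_part x) (delta_mx 0 a) ->
  partial (base_idx a) (fun y => h (base_part y) * k (fiber_part y i)) x =
  partial a h (base_part x) * k (fiber_part x i).
Proof.
move=> dh; rewrite mulrC -[_ * _](deriveZ _ dh).
by apply: partial_eq => t; rewrite !wpartE [RHS]mulrC.
Qed.

Lemma partial_fiber_prod (k : 'rV[R]_(s i) -> R) al x :
  derivable k (fiber_part x i) (delta_mx 0 al) ->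
  partial (fiber_idx n i al) (fun y => h (base_part y) * k (fiber_part y i)) x =
  h (base_part x) * partial al k (fiber_part x i).
Proof.
move=> dk; rewrite -[_ * _](deriveZ _ dk).
by apply: partial_eq => t; rewrite !wpartE.
Qed.

Lemma partial_fiber_prod_neq (k : 'rV[R]_(s j) -> R) al x : i != j ->
  partial (fiber_idx n i al) (fun y => h (base_part y) * k (fiber_part y j)) x = 0.
Proof.
move=> ij; rewrite -(partial_cst (fiber_idx n i al)
  (h (base_part x) * k (fiber_part x j)) x).
by apply: partial_eq => t; rewrite !wpartE fiber_part_fiber_neq// !wpartE.
Qed.

End Products.
End WarpedDerivatives.

(** This is [wgcoef] in one product chart, with [beta i] standing for [b i] read in the base chart;
    the computation below thus takes place on open sets of coordinates. *)
Definition warped_metric (R : realType) (n m : nat) (s : 'I_m -> nat)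
    (gB : 'rV[R]_n -> 'M[R]_n) (gF : forall i, 'rV[R]_(s i) -> 'M[R]_(s i))
    (beta : 'I_m -> 'rV[R]_n -> R) (x : 'rV[R]_(n + \sum_(i < m) s i)) :
    'M[R]_(n + \sum_(i < m) s i) :=
  block_mx (gB (lsubmx x)) 0 0
    (\mxdiag_(i < m) (beta i (lsubmx x) ^+ 2 *: gF i (submxrow (rsubmx x) i))).

(** * Inverse and derivatives of the warped metric *)

Section WarpedConnection.
Variables (R : realType) (n m : nat) (s : 'I_m -> nat).
Variables (gB : 'rV[R]_n -> 'M[R]_n) (gF : forall i, 'rV[R]_(s i) -> 'M[R]_(s i)).
Variables (beta : 'I_m -> 'rV[R]_n -> R).
Variables (UB : set 'rV[R]_n) (UF : forall i, set 'rV[R]_(s i)).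
Arguments gF : clear implicits.
Arguments UF : clear implicits.
Hypotheses (oUB : open UB) (oUF : forall i, open (UF i)).
Hypotheses (smB : forall a b, smooth_on UB (fun u => gB u a b)).
Hypotheses (smF : forall i al be, smooth_on (UF i) (fun v => gF i v al be)).
Hypotheses (symB : forall u, UB u -> (gB u)^T = gB u).
Hypotheses (symF : forall i v, UF i v -> (gF i v)^T = gF i v).
Hypotheses (unitB : forall u, UB u -> gB u \in unitmx).
Hypotheses (unitF : forall i v, UF i v -> gF i v \in unitmx).
Hypotheses (smb : forall i, smooth_on UB (beta i)).
Hypotheses (b0 : forall i u, UB u -> beta i u != 0).

Local Notation N := (n + \sum_(i < m) s i)%N.
Local Notation G := (@warped_metric R n m s gB gF beta).
Local Notation B := base_idx.
Local Notation F := (fiber_idx n).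
Local Notation xB := base_part.
Local Notation xF := fiber_part.
Implicit Types (x y : 'rV[R]_N) (i j k : 'I_m) (a b c d : 'I_n).

Definition warped_domain x := UB (xB x) /\ forall i, UF i (xF x i).
Local Notation W := warped_domain.

(** The formulas for the Christoffel symbols hold only on [W], and differentiating them requires a
    whole piece of coordinate line inside [W]. It exists because there are finitely many fibers and
    every factor is open. *)
Lemma eq_partial_warped x (l : 'I_N) f f' : W x -> (forall y, W y -> f y = f' y) ->
  partial l f x = partial l f' x.
Proof.
move=> [Wx Wx'] ff'; apply: partial_eq_near.
have nB : \forall h \near (0 : R), UB (h *: base_part (delta_mx 0 l) + xB x).
  exact: open_near_line.
have nF : \forall h \near (0 : R),
    forall i, UF i (h *: fiber_part (delta_mx 0 l) i + xF x i).
  pose P i := [set h : R | UF i (h *: fiber_part (delta_mx 0 l) i + xF x i)].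
  by apply: (@filter_forall _ _ P (nbhs (0 : R)) _) => i; exact: open_near_line.
apply: filterS2 nB nF => h hB hF; apply: ff'; split.
  by rewrite base_part_line.
by move=> i; rewrite fiber_part_line.
Qed.

Lemma partial_warped0 x (l : 'I_N) f : W x -> (forall y, W y -> f y = 0) ->
  partial l f x = 0.
Proof.
by move=> Wx f0; rewrite (@eq_partial_warped _ _ _ (cst 0) Wx)// partial_cst.
Qed.

(** The block diagonal candidate is a right inverse; for square matrices this makes [G x] invertible
    and identifies its inverse. *)
Lemma invmx_warped x : W x ->
  invmx (G x) = block_mx (invmx (gB (xB x))) 0 0
    (\mxdiag_(i < m) ((beta i (xB x) ^+ 2)^-1 *: invmx (gF i (xF x i)))).
Proof.
move=> [Wx Wx']; set A := block_mx _ _ _ _.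
have GA : G x *m A = 1%:M.
  rewrite mulmx_block !mul0mx !mulmx0 !addr0 add0r mulmxV ?unitB//.
  rewrite [RHS]scalar_mx_block; congr block_mx.
  rewrite -mxdiagZ {2}/mxdiag mul_mxdiag_mxblock; apply: eq_mxblock => i j.
  case: eqVneq => [<-|_]; last by rewrite mulmx0.
  rewrite !conform_mx_id -scalemxAl -scalemxAr scalerA mulmxV ?unitF//.
  by rewrite mulfV ?scale1r// expf_neq0// b0.
have [uG _] := mulmx1_unit GA.
by rewrite -[LHS]mulmx1 -GA mulKmx.
Qed.

Section MetricDerivatives.
Variables (x : 'rV[R]_N) (Wx : W x).

Lemma partial_metric_base_base d a b :
  partial (B d) (fun y => G y (B a) (B b)) x = partial d (fun u => gB u a b) (xB x).
Proof.
rewrite -(@partial_base_base _ _ _ s (fun u => gB u a b)).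
by apply: partial_eq => h; rewrite block_diag_base.
Qed.

Lemma partial_metric_fiber_base i al a b :
  partial (F i al) (fun y => G y (B a) (B b)) x = 0.
Proof.
rewrite -(@partial_fiber_base _ _ _ s i (fun u => gB u a b) al x).
by apply: partial_eq => h; rewrite block_diag_base.
Qed.

Lemma partial_metric_mixed (l : 'I_N) a i al :
  partial l (fun y => G y (B a) (F i al)) x = 0.
Proof. by apply: partial_warped0 => // y _; rewrite block_diag_base_fiber. Qed.

Lemma partial_metric_mixed' (l : 'I_N) a i al :
  partial l (fun y => G y (F i al) (B a)) x = 0.
Proof. by apply: partial_warped0 => // y _; rewrite block_diag_fiber_base. Qed.

Lemma partial_metric_fiber_neq (l : 'I_N) i j al be : i != j ->
  partial l (fun y => G y (F i al) (F j be)) x = 0.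
Proof.
by move=> ij; apply: partial_warped0 => // y _; rewrite block_diag_fiber_neq.
Qed.

Lemma partial_metric_base_fiber a i al be :
  partial (B a) (fun y => G y (F i al) (F i be)) x =
  2 * beta i (xB x) * partial a (beta i) (xB x) * gF i (xF x i) al be.
Proof.
have [Wx1 _] := Wx; have db := smooth_derivable (j := a) (@smb i) Wx1.
transitivity (partial a (fun u => beta i u * beta i u) (xB x) * gF i (xF x i) al be).
  rewrite -(@partial_base_prod _ _ _ s i (fun u => beta i u * beta i u)
              (fun v => gF i v al be)); last exact: (derivableM db db).
  by apply: partial_eq => h; rewrite block_diag_fiber mxE expr2.
by rewrite /partial (deriveM db db) /=; congr (_ * _); rewrite /GRing.scale/=; ring.
Qed.

Lemma partial_metric_fiber i ga al be :
  partial (F i ga) (fun y => G y (F i al) (F i be)) x =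
  beta i (xB x) ^+ 2 * partial ga (fun v => gF i v al be) (xF x i).
Proof.
have [_ Wx2] := Wx; have dF := smooth_derivable (j := ga) (@smF i al be) (Wx2 i).
rewrite -(@partial_fiber_prod _ _ _ s i (fun u => beta i u ^+ 2)
            (fun v => gF i v al be))//.
by apply: partial_eq => h; rewrite block_diag_fiber mxE.
Qed.

Lemma partial_metric_fiber_other i j k ga al be : i != j ->
  partial (F i ga) (fun y => G y (F j al) (F k be)) x = 0.
Proof.
move=> ij; have [jk|jk] := eqVneq j k; last exact: partial_metric_fiber_neq.
case: _ / jk in be *.
rewrite -(@partial_fiber_prod_neq _ _ _ s i j (fun u => beta j u ^+ 2)
            (fun v => gF j v al be) ga x)//.
by apply: partial_eq => h; rewrite block_diag_fiber mxE.
Qed.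

End MetricDerivatives.

Definition partial_metricE := (partial_metric_base_base, partial_metric_fiber_base,
  partial_metric_mixed, partial_metric_mixed', partial_metric_base_fiber,
  partial_metric_fiber, addr0, add0r, subr0, sub0r, oppr0).

(** * Christoffel symbols of the warped metric *)

Section Christoffel.
Variables (x : 'rV[R]_N) (Wx : W x).
Local Notation Gam k i j := (christoffel G k i j x).

(** The inverse metric is block diagonal, so raising an index stays within the block;
    [christoffel_fiber_row] rests on the same fact. *)
Lemma christoffel_base_row c (i j : 'I_N) :
  Gam (B c) i j = 2^-1 * \sum_d invmx (gB (xB x)) c d *
    (partial i (fun y => G y j (B d)) x + partial j (fun y => G y i (B d)) x
     - partial (B d) (fun y => G y i j) x).
Proof.
rewrite /christoffel invmx_warped//; congr (_ * _).
rewrite big_widx_base => [|k al]; last by rewrite block_diag_base_fiber mul0r.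
by apply: eq_bigr => d _; rewrite block_diag_base.
Qed.

Lemma christoffel_fiber_row k ga (i j : 'I_N) :
  Gam (F k ga) i j = 2^-1 * \sum_de ((beta k (xB x) ^+ 2)^-1 *
     invmx (gF k (xF x k)) ga de) *
    (partial i (fun y => G y j (F k de)) x + partial j (fun y => G y i (F k de)) x
     - partial (F k de) (fun y => G y i j) x).
Proof.
rewrite /christoffel invmx_warped//; congr (_ * _).
rewrite (@big_widx_fiber _ _ _ _ _ k).
- by apply: eq_bigr => d _; rewrite block_diag_fiber mxE.
- by move=> a; rewrite block_diag_fiber_base mul0r.
- by move=> j' al jk; rewrite block_diag_fiber_neq ?mul0r// eq_sym.
Qed.

Lemma christoffel_BBB c a b : Gam (B c) (B a) (B b) = christoffel gB c a b (xB x).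
Proof.
rewrite christoffel_base_row; congr (_ * _); apply: eq_bigr => d _.
by rewrite !partial_metricE.
Qed.

Lemma christoffel_FBB k ga a b : Gam (F k ga) (B a) (B b) = 0.
Proof.
rewrite christoffel_fiber_row big1 ?mulr0// => d _.
by rewrite !partial_metricE// mulr0.
Qed.

Lemma christoffel_mixed_sym (l : 'I_N) a i al :
  Gam l (F i al) (B a) = Gam l (B a) (F i al).
Proof. by apply: christoffel_swap => l'; rewrite !partial_metricE. Qed.

Lemma christoffel_BBF c a i al : Gam (B c) (B a) (F i al) = 0.
Proof.
rewrite christoffel_base_row big1 ?mulr0// => d _.
by rewrite !partial_metricE// mulr0.
Qed.

(** Only the derivative of [b_i^2 g_(F_i)] along the base survives. Half of it, contracted with
    [b_i^-2 g_(F_i)^-1], is the logarithmic derivative of [b_i] times the identity. *)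
Lemma christoffel_FBF i ga a al : Gam (F i ga) (B a) (F i al) =
  partial a (beta i) (xB x) / beta i (xB x) * (ga == al)%:R.
Proof.
have [Wx1 Wx2] := Wx; have bn0 := @b0 i _ Wx1.
rewrite christoffel_fiber_row.
transitivity (partial a (beta i) (xB x) / beta i (xB x) *
  \sum_de invmx (gF i (xF x i)) ga de * gF i (xF x i) de al).
  rewrite !mulr_sumr; apply: eq_bigr => d _; rewrite !partial_metricE//.
  by rewrite (metric_entry_sym (@symF i) _ al)//; field.
by have := mulVmx (unitF (Wx2 i)) => /matrixP/(_ ga al); rewrite !mxE => ->.
Qed.

Lemma christoffel_FBF_neq i k ga a al : k != i -> Gam (F k ga) (B a) (F i al) = 0.
Proof.
move=> ki; rewrite christoffel_fiber_row big1 ?mulr0// => d _.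
by rewrite !partial_metricE// !partial_metric_fiber_neq ?mulr0 1?eq_sym// !addr0 mulr0.
Qed.

(** Only the term with the minus sign survives: half the differential of [b_i^2] is [b_i] times that
    of [b_i], and the inverse base metric turns it into the gradient. *)
Lemma christoffel_BFF c i al be : Gam (B c) (F i al) (F i be) =
  - (beta i (xB x) * gradient gB (beta i) (xB x) 0 c) * gF i (xF x i) al be.
Proof.
have [Wx1 _] := Wx; rewrite christoffel_base_row gradientE.
rewrite mulNr mulrAC !mulr_sumr -sumrN.
apply: eq_bigr => d _; rewrite !partial_metricE//.
by rewrite (invmx_entry_sym symB _ c)//; field.
Qed.

Lemma christoffel_FF_neq (l : 'I_N) i j al be : i != j -> Gam l (F i al) (F j be) = 0.
Proof.
move=> ij; have ji : j != i by rewrite eq_sym.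
move: l; apply: widxP => [c|k ga].
  rewrite christoffel_base_row big1 ?mulr0// => d _.
  by rewrite !partial_metricE// partial_metric_fiber_neq// oppr0 mulr0.
rewrite christoffel_fiber_row big1 ?mulr0// => d _.
rewrite [X in _ - X]partial_metric_fiber_neq// !partial_metric_fiber_other//.
by rewrite !addr0 subr0 mulr0.
Qed.

(** Along the fiber [b_i] is constant, and Christoffel symbols do not change when the metric is
    multiplied by a constant. *)
Lemma christoffel_FFF i ga al be :
  Gam (F i ga) (F i al) (F i be) = christoffel (gF i) ga al be (xF x i).
Proof.
have [Wx1 _] := Wx; have bn0 := @b0 i _ Wx1.
rewrite christoffel_fiber_row; congr (_ * _); apply: eq_bigr => d _.
by rewrite !partial_metricE//; field.
Qed.

Lemma christoffel_FFF_neq i k ga al be : k != i -> Gam (F k ga) (F i al) (F i be) = 0.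
Proof.
move=> ki; rewrite christoffel_fiber_row big1 ?mulr0// => d _.
rewrite partial_metric_fiber_neq 1?eq_sym// partial_metric_fiber_neq 1?eq_sym//.
by rewrite partial_metric_fiber_other// addr0 subr0 mulr0.
Qed.

End Christoffel.

Lemma sum_delta n' (f : 'I_n' -> R) al : \sum_be f be * (al == be)%:R = f al.
Proof.
rewrite (bigD1 al)//= eqxx mulr1 big1 ?addr0// => be; rewrite eq_sym => /negbTE->.
by rewrite mulr0.
Qed.

(** The product of first derivatives that appears here cancels in [ricci_base] against the quadratic
    part of the Ricci formula. *)
Lemma partial_quotient a b i u : UB u ->
  partial a (fun u' => partial b (beta i) u' / beta i u') u =
  partial a (partial b (beta i)) u / beta i u
  - partial a (beta i) u * partial b (beta i) u / beta i u ^+ 2.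
Proof.
move=> Uu; have bn0 := @b0 i _ Uu.
have db := smooth_derivable (j := a) (@smb i) Uu.
have ddb := smooth_partial_derivable (i := b) (j := a) (@smb i) Uu.
rewrite {1}/partial (deriveM ddb (derivableV bn0 db)) (deriveV bn0 db).
by rewrite -!/(partial _ _ _) /GRing.scale/=; field.
Qed.

(** * The blocks of the Ricci matrix *)

Section WarpedRicci.
Variables (x : 'rV[R]_N) (Wx : W x).
Let Wx1 : UB (xB x) := proj1 Wx.
Let Wx2 : forall i, UF i (xF x i) := proj2 Wx.
Local Notation Gam k i j := (christoffel G k i j).

Lemma partial_christoffel_BBB d c a b : partial (B d) (Gam (B c) (B a) (B b)) x =
  partial d (christoffel gB c a b) (xB x).
Proof.
rewrite -(@partial_base_base _ _ _ s); apply: eq_partial_warped => // y Wy.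
exact: christoffel_BBB.
Qed.

Lemma partial_christoffel_FBF d i ga a al :
  partial (B d) (Gam (F i ga) (B a) (F i al)) x =
  partial d (fun u => partial a (beta i) u / beta i u) (xB x) * (ga == al)%:R.
Proof.
have [gaal|gaal] := eqVneq ga al; last first.
  rewrite mulr0; apply: partial_warped0 => // y Wy.
  by rewrite christoffel_FBF// (negbTE gaal) mulr0.
rewrite mulr1 -(@partial_base_base _ _ _ s).
apply: eq_partial_warped => // y Wy.
by rewrite christoffel_FBF// gaal eqxx mulr1.
Qed.

Lemma partial_christoffel_FFF i (de ga al be : 'I_(s i)) :
  partial (F i de) (Gam (F i ga) (F i al) (F i be)) x =
  partial de (christoffel (gF i) ga al be) (xF x i).
Proof.
rewrite -(@partial_fiber_fiber _ n _ s); apply: eq_partial_warped => // y Wy.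
exact: christoffel_FFF.
Qed.

(** Each term of the trace with lower index in [F_k] is zero or a Christoffel symbol of [F_k], hence
    does not vary with the base point. The next lemma uses the same fact along another fiber. *)
Lemma partial_trace_fiber_base (a : 'I_n) (l : 'I_N) k al :
  partial (B a) (Gam l l (F k al)) x = 0.
Proof.
move: l; apply: widxP => [c|i ga].
  by apply: partial_warped0 => // y Wy; exact: christoffel_BBF.
have [ik|ik] := eqVneq i k; last first.
  by apply: partial_warped0 => // y Wy; exact: christoffel_FF_neq.
case: _ / ik in al *.
rewrite -(@partial_base_fiber _ n _ s i (christoffel (gF i) ga ga al) a x).
by apply: eq_partial_warped => // y Wy; exact: christoffel_FFF.
Qed.

Lemma partial_trace_fiber_neq i k (de : 'I_(s i)) (l : 'I_N) al : i != k ->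
  partial (F i de) (Gam l l (F k al)) x = 0.
Proof.
move=> ik; move: l; apply: widxP => [c|j ga].
  by apply: partial_warped0 => // y Wy; exact: christoffel_BBF.
have [jk|jk] := eqVneq j k; last first.
  by apply: partial_warped0 => // y Wy; exact: christoffel_FF_neq.
case: _ / jk in al ik *.
rewrite -(@partial_fiber_fiber_neq _ n _ s i j (christoffel (gF j) ga ga al) de x ik).
by apply: eq_partial_warped => // y Wy; exact: christoffel_FFF.
Qed.

(** The trace is the logarithmic derivative of the volume density, to which each fiber contributes a
    factor [b_i^(s_i)]. *)
Lemma trace_base a : \sum_l Gam l l (B a) x =
  \sum_c christoffel gB c c a (xB x)
  + \sum_i (s i)%:R * (partial a (beta i) (xB x) / beta i (xB x)).
Proof.
rewrite big_widx; congr (_ + _).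
  by apply: eq_bigr => c _; rewrite christoffel_BBB.
apply: eq_bigr => i _.
under eq_bigr do rewrite christoffel_mixed_sym// christoffel_FBF// eqxx mulr1.
by rewrite sumr_const card_ord mulr_natl.
Qed.

Lemma trace_fiber i al : \sum_l Gam l l (F i al) x =
  \sum_ga christoffel (gF i) ga ga al (xF x i).
Proof.
rewrite (@big_widx_fiber _ _ _ _ _ i).
- by apply: eq_bigr => ga _; rewrite christoffel_FFF.
- by move=> c; rewrite christoffel_BBF.
- by move=> j ga ji; rewrite christoffel_FF_neq.
Qed.

(** Each of the four sums is the corresponding sum of the base plus a fiber correction, the first
    one with zero correction. The corrections add up to the Hessian terms. *)
Lemma ricci_base a b : ricci G x (B a) (B b) =
  ricci gB (xB x) a b
  - \sum_i (s i)%:R / beta i (xB x) * hessian gB (beta i) (xB x) a b.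
Proof.
have E1 : \sum_l partial l (Gam l (B a) (B b)) x =
          \sum_c partial c (christoffel gB c a b) (xB x).
  rewrite big_widx_base => [|i al].
    by apply: eq_bigr => c _; exact: partial_christoffel_BBB.
  by apply: partial_warped0 => // y Wy; exact: christoffel_FBB.
have E2 : \sum_l partial (B a) (Gam l l (B b)) x =
    \sum_c partial a (christoffel gB c c b) (xB x) + \sum_i (s i)%:R *
      (partial a (partial b (beta i)) (xB x) / beta i (xB x)
       - partial a (beta i) (xB x) * partial b (beta i) (xB x) / beta i (xB x) ^+ 2).
  rewrite big_widx; congr (_ + _); [apply: eq_bigr => c _|apply: eq_bigr => i _].
    exact: partial_christoffel_BBB.
  rewrite -partial_quotient// mulr_natl -[X in _ *+ X]card_ord -sumr_const.
  apply: eq_bigr => al _; have := partial_christoffel_FBF a al b al.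
  rewrite eqxx mulr1 => <-; apply: eq_partial_warped => // y Wy.
  exact: christoffel_mixed_sym.
have E3 : \sum_l (\sum_l' Gam l' l' l x) * Gam l (B a) (B b) x =
    \sum_c (\sum_c' christoffel gB c' c' c (xB x)) * christoffel gB c a b (xB x)
    + \sum_i (s i)%:R / beta i (xB x) *
        \sum_c christoffel gB c a b (xB x) * partial c (beta i) (xB x).
  rewrite big_widx_base => [|i al]; last by rewrite christoffel_FBB// mulr0.
  under eq_bigr do rewrite trace_base christoffel_BBB// mulrDl.
  rewrite big_split/=; congr (_ + _).
  under [RHS]eq_bigr do rewrite mulr_sumr.
  rewrite [RHS]exchange_big/=; apply: eq_bigr => c _; rewrite mulr_suml.
  by apply: eq_bigr => i _; ring.
have E4 : \sum_l \sum_l' Gam l (B a) l' x * Gam l' l (B b) x =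
    \sum_c \sum_d christoffel gB c a d (xB x) * christoffel gB d c b (xB x)
    + \sum_i (s i)%:R *
       (partial a (beta i) (xB x) * partial b (beta i) (xB x) / beta i (xB x) ^+ 2).
  rewrite big_widx; congr (_ + _); [apply: eq_bigr => c _|apply: eq_bigr => i _].
    rewrite big_widx_base => [|i al]; last by rewrite christoffel_BBF// mul0r.
    by apply: eq_bigr => d _; rewrite !christoffel_BBB.
  rewrite mulr_natl -[X in _ *+ X]card_ord -sumr_const.
  apply: eq_bigr => al _; rewrite (@big_widx_fiber _ _ _ _ _ i).
  - under eq_bigr => be _.
      rewrite christoffel_FBF// mulrAC christoffel_mixed_sym// christoffel_FBF//; over.
    by rewrite sum_delta eqxx mulr1; have := @b0 i _ Wx1 => bn0; field.
  - by move=> c; rewrite christoffel_FBB// mul0r.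
  - by move=> j be ji; rewrite christoffel_FBF_neq ?mul0r// eq_sym.
rewrite (ricci_parts E1 E2 E3 E4) ricciE.
have -> : \sum_i (s i)%:R / beta i (xB x) * hessian gB (beta i) (xB x) a b =
    \sum_i (s i)%:R *
      (partial a (partial b (beta i)) (xB x) / beta i (xB x)
       - partial a (beta i) (xB x) * partial b (beta i) (xB x) / beta i (xB x) ^+ 2)
    - \sum_i (s i)%:R / beta i (xB x) *
        \sum_c christoffel gB c a b (xB x) * partial c (beta i) (xB x)
    + \sum_i (s i)%:R *
       (partial a (beta i) (xB x) * partial b (beta i) (xB x) / beta i (xB x) ^+ 2).
  rewrite -sumrB -big_split; apply: eq_bigr => i _ /=; rewrite hessianE.
  by have := @b0 i _ Wx1 => bn0; field.
(* The identity is stated for arbitrary reals, so that [ring] meets no sums. *)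
have regroup (t1 t2 t3 t4 u v w : R) :
  t1 - (t2 + u) + (t3 + v) - (t4 + w) = t1 - t2 + t3 - t4 - (u - v + w) by ring.
exact: regroup.
Qed.

(** The derivative sums vanish, and the two quadratic sums are both the logarithmic derivative of
    [b_i] times the trace of the fiber connection, so they cancel. *)
Lemma ricci_base_fiber a i al : ricci G x (B a) (F i al) = 0.
Proof.
have E1 : \sum_l partial l (Gam l (B a) (F i al)) x = 0.
  apply: big_widx0 => [c|k ga].
    by apply: partial_warped0 => // y Wy; exact: christoffel_BBF.
  have [ki|ki] := eqVneq k i; last first.
    by apply: partial_warped0 => // y Wy; exact: christoffel_FBF_neq.
  case: _ / ki in al *.
  (* The remaining symbol depends on the base point only and is differentiated along the fiber. *)
  rewrite -(@partial_fiber_base _ _ _ s k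
    (fun u => partial a (beta k) u / beta k u * (ga == al)%:R) ga x).
  by apply: eq_partial_warped => // y Wy; exact: christoffel_FBF.
have E2 : \sum_l partial (B a) (Gam l l (F i al)) x = 0.
  by apply: big1 => l _; exact: partial_trace_fiber_base.
pose q := partial a (beta i) (xB x) / beta i (xB x).
have E3 : \sum_l (\sum_l' Gam l' l' l x) * Gam l (B a) (F i al) x =
          \sum_ga christoffel (gF i) ga ga al (xF x i) * q.
  rewrite (@big_widx_fiber _ _ _ _ _ i).
  - under eq_bigr => ga _.
      rewrite trace_fiber christoffel_FBF// eq_sym mulrA; over.
    by rewrite sum_delta mulr_suml.
  - by move=> c; rewrite christoffel_BBF// mulr0.
  - by move=> j be ji; rewrite christoffel_FBF_neq ?mulr0.
have E4 : \sum_l \sum_l' Gam l (B a) l' x * Gam l' l (F i al) x =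
          \sum_ga christoffel (gF i) ga ga al (xF x i) * q.
  rewrite (@big_widx_fiber _ _ _ _ _ i).
  - apply: eq_bigr => ga _; rewrite (@big_widx_fiber _ _ _ _ _ i).
    + under eq_bigr do rewrite christoffel_FBF// christoffel_FFF// mulrAC.
      by rewrite sum_delta mulrC.
    + by move=> c; rewrite christoffel_FBB// mul0r.
    + by move=> j be ji; rewrite christoffel_FBF_neq ?mul0r// eq_sym.
  - move=> c; apply: big_widx0 => [d|j be].
      by rewrite christoffel_BBF// mulr0.
    by rewrite christoffel_BBF// mul0r.
  - move=> j be ji; apply: big_widx0 => [d|k ga].
      by rewrite christoffel_FBB// mul0r.
    have [kj|kj] := eqVneq k j; last by rewrite christoffel_FBF_neq ?mul0r// eq_sym.
    by case: _ / kj in be ji *; rewrite christoffel_FF_neq ?mulr0.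
by rewrite (ricci_parts E1 E2 E3 E4) subrr add0r subrr.
Qed.

(** The transposed block is computed directly instead of through a symmetry of Ric. Here [E2]
    vanishes because traces with a base index depend on the base point only, and [E4] matches [E3]
    by the symmetry of the fiber connection. *)
Lemma ricci_fiber_base a i al : ricci G x (F i al) (B a) = 0.
Proof.
have E1 : \sum_l partial l (Gam l (F i al) (B a)) x = 0.
  apply: big_widx0 => [c|k ga].
    apply: partial_warped0 => // y Wy.
    by rewrite christoffel_mixed_sym// christoffel_BBF.
  have [ki|ki] := eqVneq k i; last first.
    apply: partial_warped0 => // y Wy.
    by rewrite christoffel_mixed_sym// christoffel_FBF_neq.
  case: _ / ki in al *.
  rewrite -(@partial_fiber_base _ _ _ s k
    (fun u => partial a (beta k) u / beta k u * (ga == al)%:R) ga x).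
  apply: eq_partial_warped => // y Wy.
  by rewrite christoffel_mixed_sym// christoffel_FBF.
have E2 : \sum_l partial (F i al) (Gam l l (B a)) x = 0.
  apply: big_widx0 => [c|k ga].
    rewrite -(@partial_fiber_base _ _ _ s i (christoffel gB c c a) al x).
    by apply: eq_partial_warped => // y Wy; exact: christoffel_BBB.
  rewrite -(@partial_fiber_base _ _ _ s i
    (fun u => partial a (beta k) u / beta k u * (ga == ga)%:R) al x).
  apply: eq_partial_warped => // y Wy.
  by rewrite christoffel_mixed_sym// christoffel_FBF.
pose q := partial a (beta i) (xB x) / beta i (xB x).
have E3 : \sum_l (\sum_l' Gam l' l' l x) * Gam l (F i al) (B a) x =
          \sum_ga christoffel (gF i) ga ga al (xF x i) * q.
  rewrite (@big_widx_fiber _ _ _ _ _ i).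
  - under eq_bigr => ga _.
      rewrite trace_fiber christoffel_mixed_sym// christoffel_FBF// eq_sym mulrA; over.
    by rewrite sum_delta mulr_suml.
  - by move=> c; rewrite christoffel_mixed_sym// christoffel_BBF// mulr0.
  - by move=> j be ji; rewrite christoffel_mixed_sym// christoffel_FBF_neq ?mulr0.
have E4 : \sum_l \sum_l' Gam l (F i al) l' x * Gam l' l (B a) x =
          \sum_ga christoffel (gF i) ga ga al (xF x i) * q.
  rewrite (@big_widx_fiber _ _ _ _ _ i).
  - apply: eq_bigr => ga _; rewrite (@big_widx_fiber _ _ _ _ _ i).
    + under eq_bigr => be _.
        rewrite christoffel_mixed_sym// christoffel_FBF// christoffel_FFF//.
        rewrite eq_sym mulrA; over.
      by rewrite sum_delta (christoffel_sym (@oUF i) (@symF i)).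
    + by move=> c; rewrite !christoffel_mixed_sym// christoffel_BBF// mulr0.
    + by move=> j be ji; rewrite christoffel_FF_neq ?mul0r// eq_sym.
  - move=> c; apply: big_widx0 => [d|j be].
      by rewrite christoffel_mixed_sym// christoffel_BBF// mul0r.
    by rewrite christoffel_FBB// mulr0.
  - move=> j be ji; apply: big_widx0 => [d|k ga].
      by rewrite christoffel_mixed_sym// christoffel_FBF_neq ?mul0r.
    have [ik|ik] := eqVneq i k; last by rewrite christoffel_FF_neq ?mul0r.
    by case: _ / ik in ga *; rewrite christoffel_FFF_neq ?mul0r.
by rewrite (ricci_parts E1 E2 E3 E4) subrr add0r subrr.
Qed.

(** Symbols with lower indices in two different fibers vanish, which settles [E1] and [E3]; the
    trace in [E2] is constant along [F_i]; in [E4] every product has a zero factor. *)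
Lemma ricci_fiber_neq i j al be : i != j -> ricci G x (F i al) (F j be) = 0.
Proof.
move=> ij.
have E1 : \sum_l partial l (Gam l (F i al) (F j be)) x = 0.
  apply: big1 => l _; apply: partial_warped0 => // y Wy.
  exact: christoffel_FF_neq.
have E2 : \sum_l partial (F i al) (Gam l l (F j be)) x = 0.
  by apply: big1 => l _; exact: partial_trace_fiber_neq.
have E3 : \sum_l (\sum_l' Gam l' l' l x) * Gam l (F i al) (F j be) x = 0.
  by apply: big1 => l _; rewrite christoffel_FF_neq ?mulr0.
have E4 : \sum_l \sum_l' Gam l (F i al) l' x * Gam l' l (F j be) x = 0.
  apply: big_widx0 => [c|k ga]; apply: big_widx0 => [d|k' ga'].
  - by rewrite christoffel_mixed_sym// christoffel_BBF// mul0r.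
  - have [ik|ik] := eqVneq i k'; last by rewrite christoffel_FF_neq ?mul0r.
    by case: _ / ik in ga' *; rewrite christoffel_FBF_neq ?mulr0.
  - have [jk|jk] := eqVneq j k; last first.
      by rewrite (@christoffel_FF_neq _ _ _ k) ?mulr0// eq_sym.
    case: _ / jk in ga *.
    by rewrite christoffel_mixed_sym// christoffel_FBF_neq ?mul0r// eq_sym.
  - have [jk|jk] := eqVneq j k; last first.
      by rewrite (@christoffel_FF_neq _ _ _ k) ?mulr0// eq_sym.
    case: _ / jk in ga *.
    have [ik|ik] := eqVneq i k'; last by rewrite christoffel_FF_neq ?mul0r.
    by case: _ / ik in ga' *; rewrite christoffel_FFF_neq ?mul0r// eq_sym.
by rewrite (ricci_parts E1 E2 E3 E4) subrr add0r subrr.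
Qed.

Lemma inner_gradient f v u : UB u ->
  inner gB u (gradient gB f u) v = \sum_c partial c f u * v 0 c.
Proof.
move=> Uu; rewrite /inner /gradient mulmxKV ?unitB// mxE.
by apply: eq_bigr => c _; rewrite !mxE.
Qed.

Lemma inner_sym u v w : UB u -> inner gB u v w = inner gB u w v.
Proof.
move=> Uu; rewrite /inner -[v *m _ *m _]trmxK [LHS]mxE.
by rewrite !trmx_mul trmxK symB// mulmxA.
Qed.

(** The function Q_i. The sum includes [k = i], whose term combines with the preceding one to the
    usual [(s_i - 1) |grad b_i|^2]. *)
Definition fiber_term i u : R :=
  beta i u * laplacian gB (beta i) u
  - inner gB u (gradient gB (beta i) u) (gradient gB (beta i) u)
  + \sum_k (s k)%:R * (beta i u / beta k u)
      * inner gB u (gradient gB (beta i) u) (gradient gB (beta k) u).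

(** [E1] and [E3] together contain the divergence of [grad b_i], that is the Laplacian. The square
    of the gradient enters [E1] with coefficient -1 and [E4] with -2; as [E4] is subtracted, +1 is
    left. The terms in the other [b_k] come from the trace in [E3]. *)
Lemma ricci_fiber i al be : ricci G x (F i al) (F i be) =
  ricci (gF i) (xF x i) al be - fiber_term i (xB x) * gF i (xF x i) al be.
Proof.
have bn0 := @b0 i _ Wx1; set u := xB x; set v := xF x i.
pose gr c := gradient gB (beta i) u 0 c; pose bi := beta i u; pose gam := gF i v al be.
have E1 : \sum_l partial l (Gam l (F i al) (F i be)) x =
    - (bi * (\sum_c partial c (fun w => gradient gB (beta i) w 0 c) u)
       + inner gB u (gradient gB (beta i) u) (gradient gB (beta i) u)) * gam
    + \sum_ga partial ga (christoffel (gF i) ga al be) v.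
  rewrite big_widx; congr (_ + _).
    rewrite inner_gradient// mulr_sumr -big_split -sumrN mulr_suml.
    apply: eq_bigr => c _ /=.
    have db := smooth_derivable (j := c) (@smb i) Wx1.
    have dg := derivable_gradient (c := c) (k := c) oUB smB unitB (@smb i) Wx1.
    have dbg := derivableM db dg.
    transitivity (partial c (fun w => - (beta i w * gradient gB (beta i) w 0 c)) u
                  * gam).
      rewrite -(@partial_base_prod _ _ _ s i
        (fun w => - (beta i w * gradient gB (beta i) w 0 c))
        (fun w => gF i w al be)); last exact: derivableN dbg.
      by apply: eq_partial_warped => // y Wy; exact: christoffel_BFF.
    congr (_ * _); rewrite {1}/partial (deriveN dbg) (deriveM db dg).
    by congr (- (_ + _)); exact: mulrC.
  rewrite (bigD1 i)//= [X in _ + X]big1 ?addr0 => [|k ki]; last first.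
    apply: big1 => ga _; apply: partial_warped0 => // y Wy.
    exact: christoffel_FFF_neq.
  by apply: eq_bigr => ga _; exact: partial_christoffel_FFF.
have E2 : \sum_l partial (F i al) (Gam l l (F i be)) x =
          \sum_ga partial al (christoffel (gF i) ga ga be) v.
  rewrite (@big_widx_fiber _ _ _ _ _ i).
  - by apply: eq_bigr => ga _; exact: partial_christoffel_FFF.
  - by move=> c; apply: partial_warped0 => // y Wy; exact: christoffel_BBF.
  - by move=> j ga ji; apply: partial_warped0 => // y Wy; exact: christoffel_FF_neq.
have E3 : \sum_l (\sum_l' Gam l' l' l x) * Gam l (F i al) (F i be) x =
    - (bi * (\sum_d (\sum_c christoffel gB c c d u) * gr d)
       + \sum_k (s k)%:R * (beta i u / beta k u)
          * inner gB u (gradient gB (beta i) u) (gradient gB (beta k) u)) * gam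
    + \sum_de (\sum_ga christoffel (gF i) ga ga de v) * christoffel (gF i) de al be v.
  rewrite big_widx; congr (_ + _).
    under eq_bigr do rewrite trace_base christoffel_BFF//.
    (* The logarithmic derivatives in [trace_base], contracted with [grad b_i], give the mixed inner
       products. *)
    have -> : \sum_k (s k)%:R * (beta i u / beta k u)
                * inner gB u (gradient gB (beta i) u) (gradient gB (beta k) u) =
              bi * \sum_d (\sum_k (s k)%:R * (partial d (beta k) u / beta k u)) * gr d.
      rewrite mulr_sumr; under [RHS]eq_bigr do rewrite mulr_suml mulr_sumr.
      rewrite [RHS]exchange_big; apply: eq_bigr => k _.
      rewrite inner_sym// inner_gradient// mulr_sumr; apply: eq_bigr => c _.
      by rewrite /gr /bi; ring.
    rewrite -mulrDr -big_split mulr_sumr -sumrN mulr_suml.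
    apply: eq_bigr => d _ /=; rewrite -mulrDl.
    have regroup (t w : R) : t * (- (bi * w) * gam) = - (bi * (t * w)) * gam by ring.
    exact: regroup.
  rewrite (bigD1 i)//= [X in _ + X]big1 ?addr0 => [|k ki]; last first.
    by apply: big1 => ga _; rewrite christoffel_FFF_neq ?mulr0.
  by apply: eq_bigr => ga _; rewrite trace_fiber christoffel_FFF.
have E4 : \sum_l \sum_l' Gam l (F i al) l' x * Gam l' l (F i be) x =
    - (inner gB u (gradient gB (beta i) u) (gradient gB (beta i) u) *+ 2) * gam
    + \sum_ga \sum_de christoffel (gF i) ga al de v * christoffel (gF i) de ga be v.
  (* The square of the gradient arises twice: with [l] in the base and [l'] in the fiber, and with
     these roles exchanged in [EF]. *)
  have EB : \sum_c \sum_l' Gam (B c) (F i al) l' x * Gam l' (B c) (F i be) x =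
      - inner gB u (gradient gB (beta i) u) (gradient gB (beta i) u) * gam.
    rewrite inner_gradient// -sumrN mulr_suml; apply: eq_bigr => c _.
    rewrite (@big_widx_fiber _ _ _ _ _ i).
    - under eq_bigr do rewrite christoffel_BFF// christoffel_FBF// eq_sym mulrA.
      by rewrite sum_delta /gam /u /v; field.
    - by move=> d; rewrite christoffel_mixed_sym// christoffel_BBF// mul0r.
    - by move=> j de ji; rewrite christoffel_FF_neq ?mul0r// eq_sym.
  have EF : \sum_ga \sum_l' Gam (F i ga) (F i al) l' x * Gam l' (F i ga) (F i be) x =
      - inner gB u (gradient gB (beta i) u) (gradient gB (beta i) u) * gam
      + \sum_ga \sum_de christoffel (gF i) ga al de v * christoffel (gF i) de ga be v.
    under eq_bigr do rewrite big_widx.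
    rewrite big_split/=; congr (_ + _).
      rewrite exchange_big inner_gradient// -sumrN mulr_suml; apply: eq_bigr => c _.
      under eq_bigr => ga _.
        rewrite christoffel_mixed_sym// christoffel_FBF// christoffel_BFF//.
        rewrite eq_sym mulrAC; over.
      by rewrite sum_delta /gam /u /v; field.
    apply: eq_bigr => ga _; rewrite (bigD1 i)//= [X in _ + X]big1 ?addr0 => [|k ki].
      by apply: eq_bigr => de _; rewrite !christoffel_FFF.
    by apply: big1 => de _; rewrite christoffel_FF_neq ?mul0r// eq_sym.
  rewrite big_widx EB (bigD1 i)//= EF [X in _ + (_ + X)]big1 ?addr0 => [|k ki].
    by rewrite addrA mulNr -opprD -mulrDl -mulr2n mulNr.
  apply: big1 => ga _; apply: big_widx0 => [d|k' ga'].
    by rewrite christoffel_mixed_sym// christoffel_FBF_neq ?mul0r.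
  have [ik|ik] := eqVneq i k'; last by rewrite christoffel_FF_neq ?mul0r.
  by case: _ / ik in ga' *; rewrite christoffel_FFF_neq ?mul0r.
rewrite (ricci_parts E1 E2 E3 E4) ricciE /fiber_term.
rewrite -(divergence_gradient oUB smB symB unitB (@smb i) Wx1).
have regroup (t1 t2 t3 t4 p q r w z : R) :
  - (bi * p + q) * gam + t1 - t2 + (- (bi * r + w) * gam + t3)
    - (- (q *+ 2) * gam + t4) =
  t1 - t2 + t3 - t4 - (bi * (p + r) - q + w) * gam by ring.
exact: regroup.
Qed.

End WarpedRicci.

Lemma ricci_warped_eq x lam : W x ->
  (ricci G x = lam *: G x <->
   ricci gB (xB x) = lam *: gB (xB x)
     + \sum_i ((s i)%:R / beta i (xB x)) *: hessian gB (beta i) (xB x) /\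
   forall i, ricci (gF i) (xF x i) =
     (lam * beta i (xB x) ^+ 2 + fiber_term i (xB x)) *: gF i (xF x i)).
Proof.
move=> Wx; split=> [/matrixP RG|[RB RF]].
  split=> [|i]; apply/matrixP.
    move=> a b; have := RG (B a) (B b).
    rewrite [RHS]mxE ricci_base// block_diag_base => /eqP.
    rewrite subr_eq => /eqP->; rewrite [RHS]mxE summxE.
    congr (_ + _); first by rewrite mxE.
    by apply: eq_bigr => i _; rewrite [RHS]mxE.
  move=> al be; have := RG (F i al) (F i be).
  rewrite [RHS]mxE ricci_fiber// block_diag_fiber => /eqP.
  by rewrite subr_eq [X in _ * X]mxE mulrA -mulrDl => /eqP->; rewrite [RHS]mxE.
apply/matrixP; apply: widxP => [a|i al]; apply: widxP => [b|j be].
- rewrite [RHS]mxE ricci_base// block_diag_base.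
  have -> : ricci gB (xB x) a b = lam * gB (xB x) a b
      + \sum_i (s i)%:R / beta i (xB x) * hessian gB (beta i) (xB x) a b.
    rewrite RB mxE summxE; congr (_ + _); first by rewrite mxE.
    by apply: eq_bigr => i _; rewrite [LHS]mxE.
  exact: addrK.
- by rewrite [RHS]mxE ricci_base_fiber// block_diag_base_fiber mulr0.
- by rewrite [RHS]mxE ricci_fiber_base// block_diag_fiber_base mulr0.
- have [ij|ij] := eqVneq i j; last first.
    by rewrite [RHS]mxE ricci_fiber_neq// block_diag_fiber_neq// mulr0.
  case: _ / ij in be *.
  rewrite [RHS]mxE ricci_fiber// block_diag_fiber RF !mxE; ring.
Qed.

End WarpedConnection.

(** * From coordinates to manifolds, and the equivalence *)

Section WarpedManifold.
Variables (R : realType) (n m : nat) (s : 'I_m -> nat).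
Variables (B : metricAtlas R n) (F : forall i : 'I_m, metricAtlas R (s i)).
Variable b : 'I_m -> B -> R.
Hypotheses (hB : semiRiemannian B) (hF : forall i, semiRiemannian (F i)).
Hypotheses (hb : forall i, smooth_fun (b i)) (hb0 : forall i (p : B), 0 < b i p).

(** Chart, point and membership are bundled so that a family over all fibers can be altered at a
    single index. *)
Definition chart_point (i : 'I_m) : Type :=
  {f : chart (F i) & {q : F i | dom f q}}.

(** Q_i on the manifold. It varies with [p] in general; what becomes constant is its sum with
    [lambda b_i^2]. *)
Definition fiber_constant (c : chart B) (i : 'I_m) (p : B) : R :=
  b i p * Lap c (b i) p
  - ip c p (grad c (b i) p) (grad c (b i) p)
  + \sum_(k < m) (s k)%:R * (b i p / b k p)
      * ip c p (grad c (b i) p) (grad c (b k) p).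

Lemma einstein_at (lam : R) (c : chart B) (p : B) (f : forall i, chart (F i))
    (q : forall i, F i) : dom c p -> (forall i, dom (f i) (q i)) ->
  @Ric R _ (warped F b) (c, f) (p, q) =
    lam *: @metric R _ (warped F b) (c, f) (p, q) <->
  (Ric c p = lam *: metric c p
     + \sum_(i < m) ((s i)%:R / b i p) *: Hess c (b i) p /\
   forall i, Ric (f i) (q i) =
     (lam * b i p ^+ 2 + fiber_constant c i p) *: metric (f i) (q i)).
Proof.
move=> cp fq; set x := row_mx (Defs.coord c p) (\mxrow_(i < m) Defs.coord (f i) (q i)).
have xB : base_part x = Defs.coord c p by exact: row_mxKl.
have xF i : fiber_part x i = Defs.coord (f i) (q i).
  by rewrite /fiber_part row_mxKr mxrowK.
have Wx : warped_domain (img c) (fun i => img (f i)) x.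
  by split=> [|i]; rewrite ?xB ?xF; [exists p|exists (q i)].
(* In the chart, the warping function is [b i] after [param c]; at the coordinates of [p] it takes
   the value [b i p]. *)
have bE i : (b i \o param c) (Defs.coord c p) = b i p by rewrite /= (coordK hB).
have b0 i u : img c u -> (b i \o param c) u != 0 by rewrite lt0r_neq0 ?hb0.
have := ricci_warped_eq (@img_open _ _ _ hB c) (fun i => @img_open _ _ _ (hF i) (f i))
  (@metric_smooth _ _ _ hB c) (fun i => @metric_smooth _ _ _ (hF i) (f i))
  (@Defs.metric_sym _ _ _ hB c) (fun i => @Defs.metric_sym _ _ _ (hF i) (f i))
  (@metric_nondegenerate _ _ _ hB c) (fun i => @metric_nondegenerate _ _ _ (hF i) (f i))
  (fun i => @hb i c) b0 lam Wx.
rewrite xB.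
have -> : (forall i, ricci (gcoef (f i)) (fiber_part x i) =
  (lam * (b i \o param c) (Defs.coord c p) ^+ 2
    + fiber_term s (gcoef c) (fun i => b i \o param c) i (Defs.coord c p))
     *: gcoef (f i) (fiber_part x i)) =
  (forall i, Ric (f i) (q i) =
     (lam * b i p ^+ 2 + fiber_constant c i p) *: metric (f i) (q i)).
  apply: eq_forall => i; rewrite xF bE /fiber_term bE.
  by under eq_bigr do rewrite bE.
suff -> : \sum_i ((s i)%:R / (b i \o param c) (Defs.coord c p))
      *: hessian (gcoef c) (b i \o param c) (Defs.coord c p) =
    \sum_(i < m) ((s i)%:R / b i p) *: Hess c (b i) p by [].
by apply: eq_bigr => i _; rewrite bE.
Qed.

(** A zero matrix of positive size is singular; in size 0 it is invertible, hence the condition on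
    [s i]. *)
Lemma metric_neq0 i (f : chart (F i)) (q : F i) : (0 < s i)%N -> dom f q ->
  metric f q != 0.
Proof.
have unit0 k : (0 < k)%N -> (0 : 'M[R]_k) \notin unitmx.
  by case: k => // k _; rewrite unitmxE det0 unitr0.
move=> si fq; have : metric f q \in unitmx.
  by apply: (metric_nondegenerate (hF i)); exists q.
by apply: contraTneq => ->; exact: unit0.
Qed.

Lemma chart_point_exists i : chart_point i.
Proof.
have [q _] := cid (space_nonempty (hF i)); have [f fq] := cid (dom_cover (hF i) q).
by exists f, q.
Qed.

End WarpedManifold.

Theorem corollary4p1 (R : realType) (n m : nat) (s : 'I_m -> nat)
    (B : metricAtlas R n) (F : forall i : 'I_m, metricAtlas R (s i))
    (b : 'I_m -> B -> R) (lambda : R)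
    (hB : semiRiemannian B) (hF : forall i, semiRiemannian (F i))
    (hs : forall i, (0 < s i)%N)
    (hb : forall i, smooth_fun (b i)) (hb0 : forall i (p : B), 0 < b i p) :
  (einstein (warped F b) lambda <->
   exists mu : 'I_m -> R,
     [/\ forall (c : chart B) (p : B), dom c p ->
           Ric c p = lambda *: metric c p
             + \sum_(i < m) ((s i)%:R / b i p) *: Hess c (b i) p,
         forall i, einstein (F i) (mu i)
       & forall i (c : chart B) (p : B), dom c p ->
           lambda * b i p ^+ 2 =
           mu i - (b i p * Lap c (b i) p
                   - ip c p (grad c (b i) p) (grad c (b i) p)
                   + \sum_(k < m) (s k)%:R * (b i p / b k p)
                       * ip c p (grad c (b i) p) (grad c (b k) p))])
  /\
  (forall (i : 'I_m) (mu_i : R) (c : chart B) (p : B), dom c p ->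
     lambda * b i p ^+ 2 =
     mu_i - (b i p * Lap c (b i) p
             - ip c p (grad c (b i) p) (grad c (b i) p)
             + \sum_(k < m) (s k)%:R * (b i p / b k p)
                 * ip c p (grad c (b i) p) (grad c (b k) p))
     <->
     b i p ^+ 2 *
       (\sum_(k < m) (s k)%:R
            * ip c p ((b i p)^-1 *: grad c (b i) p) ((b k p)^-1 *: grad c (b k) p)
        + Lap c (b i) p / b i p
        - ip c p (grad c (b i) p) (grad c (b i) p) / b i p ^+ 2
        + lambda)
     - mu_i = 0).
Proof.
split; last first.
  move=> i mu c p cp; have bi0 : b i p != 0 by rewrite lt0r_neq0 ?hb0.
  have -> : b i p ^+ 2 *
       (\sum_(k < m) (s k)%:R
            * ip c p ((b i p)^-1 *: grad c (b i) p) ((b k p)^-1 *: grad c (b k) p)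
        + Lap c (b i) p / b i p
        - ip c p (grad c (b i) p) (grad c (b i) p) / b i p ^+ 2
        + lambda) - mu = lambda * b i p ^+ 2 + fiber_constant s b c i p - mu.
    (* By bilinearity the scalars [1 / b_i] and [1 / b_k] leave the inner product; a factor [b_i^-2]
       then comes out of the whole sum. *)
    have -> : \sum_(k < m) (s k)%:R
        * ip c p ((b i p)^-1 *: grad c (b i) p) ((b k p)^-1 *: grad c (b k) p) =
      b i p ^- 2 * \sum_(k < m) (s k)%:R * (b i p / b k p)
        * ip c p (grad c (b i) p) (grad c (b k) p).
      rewrite mulr_sumr; apply: eq_bigr => k _.
      have bk0 : b k p != 0 by rewrite lt0r_neq0 ?hb0.
      rewrite /ip /inner -!scalemxAl linearZ/= -scalemxAr !mxE.
      by field; rewrite bi0 bk0.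
    by rewrite /fiber_constant; field.
  split=> [->|/eqP]; first by rewrite subrK subrr.
  by rewrite subr_eq0 eq_sym -subr_eq => /eqP.
split=> [E|[mu [hA hE hC]]]; last first.
  move=> [c f] [p q] [/= cp fq]; apply/einstein_at => //; split=> [|i]; first exact: hA.
  by rewrite (hC i c p cp) subrK hE.
pose t0 i := chart_point_exists hF i.
(* A point of the product needs a point in every fiber; [t] supplies one together with a chart
   around it. *)
have key (t : forall i, chart_point F i) c p (cp : dom c p) :=
  (einstein_at hB hF hb hb0 lambda cp (fun i => svalP (projT2 (t i)))).1
    (E (c, fun i => projT1 (t i)) (p, fun i => sval (projT2 (t i)))
       (conj cp (fun i => svalP (projT2 (t i))))).
(* The given point of [F_i] is completed by arbitrary points of the other fibers: [t0] altered at
   [i]. *)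
have fib i (f : chart (F i)) q c p : dom f q -> dom c p ->
    Ric f q = (lambda * b i p ^+ 2 + fiber_constant s b c i p) *: metric f q.
  move=> fq cp; have := (key (dfwith t0 i (existT _ f (exist _ q fq) : chart_point F i))
    c p cp).2 i.
  by rewrite dfwithin.
have [p0 _] := space_nonempty hB; have [c0 cp0] := dom_cover hB p0.
(* The constant is the factor of [g_(F_i)] evaluated at one fixed base point [p0] in one chart
   [c0]. *)
exists (fun i => lambda * b i p0 ^+ 2 + fiber_constant s b c0 i p0); split.
- by move=> c p cp; exact: (key t0 c p cp).1.
- by move=> i f q fq; exact: fib.
- move=> i c p cp; have [f [q fq]] := t0 i.
  (* At one point of [F_i] the same Ricci matrix is written with the factors at [p] and at [p0]; as
     the metric there is nonzero, the factors agree. *)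
  have := fib i f q c p fq cp; rewrite (fib i f q c0 p0 fq cp0) => /eqP.
  rewrite -subr_eq0 -scalerBl scaler_eq0 (negbTE (metric_neq0 hF (hs i) fq)).
  by rewrite orbF subr_eq0 => /eqP->; rewrite addrK.
Qed.
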